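(* Let $S\in\mathcal{I}_1\cap\mathcal{I}_2$ be such that the shortest $s$–$t$ path in $G(S)$ has length $2(\ell+1)$, and let $\Pi_\ell=(B_1,A_1,\dots,A_\ell,B_{\ell+1})$ and $\widetilde{\Pi}_\ell=(\widetilde{B}_1,\widetilde{A}_1,\dots,\widetilde{A}_\ell,\widetilde{B}_{\ell+1})$ be augmenting sets in $G(S)$ with $\Pi_\ell\subseteq\widetilde{\Pi}_\ell$ (i.e. $B_k\subseteq\widetilde{B}_k$ and $A_k\subseteq\widetilde{A}_k$ for all $k$). Let $S'=S\oplus\Pi_\ell:=S+B_1-A_1+B_2-\cdots-A_\ell+B_{\ell+1}$. Then $\widetilde{\Pi}_\ell\setminus\Pi_\ell:=(\widetilde{B}_1\setminus B_1,\widetilde{A}_1\setminus A_1,\dots,\widetilde{B}_{\ell+1}\setminus B_{\ell+1})$ is an augmenting set in $G(S')$, i.e. it satisfies conditions (a)–(f) below with $S$ replaced by $S'$ and the layers $D_i$ replaced by the layers of $G(S')$.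
   Context: $\mathcal{M}_1=(V,\mathcal{I}_1)$, $\mathcal{M}_2=(V,\mathcal{I}_2)$ are matroids. For $T\in\mathcal{I}_1\cap\mathcal{I}_2$, the exchange graph $G(T)$ is the directed graph on $V\cup\{s,t\}$ with arcs: $(s,a)$ for $a\notin T$ with $T+a\in\mathcal{I}_1$; $(a,t)$ for $a\notin T$ with $T+a\in\mathcal{I}_2$; $(a,b)$ for $a\in T$, $b\notin T$ with $T-a+b\in\mathcal{I}_1$; $(b,a)$ for $a\in T$, $b\notin T$ with $T-a+b\in\mathcal{I}_2$. $D_i$ is the set of elements of $V$ at distance exactly $i$ from $s$ in $G(T)$. An augmenting set (with parameter $\ell$) in $G(T)$ is a sequence $(B_1,A_1,\dots,A_\ell,B_{\ell+1})$ with: (a) $A_k\subseteq D_{2k}$, $B_k\subseteq D_{2k-1}$; (b) all sets have the same size $w$ (the width); (c) $T+B_1\in\mathcal{I}_1$; (d) $T+B_{\ell+1}\in\mathcal{I}_2$; (e) $T-A_k+B_{k+1}\in\mathcal{I}_1$ for $1\le k\le\ell$; (f) $T-A_k+B_k\in\mathcal{I}_2$ for $1\le k\le\ell$. It is known that $S\oplus\Pi_\ell\in\mathcal{I}_1\cap\mathcal{I}_2$, so $G(S')$ is defined. *)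

(* Defs.v *)
From HB Require Import structures.
From mathcomp Require Import all_boot.

Set Implicit Arguments.
Unset Strict Implicit.
Unset Printing Implicit Defensive.

Record matroid (V : finType) := Matroid {
  indep : {set {set V}};
  indep0 : set0 \in indep;
  indepS : forall I J : {set V}, J \subset I -> I \in indep -> J \in indep;
  indep_exchange : forall I J : {set V},
    I \in indep -> J \in indep -> #|I| < #|J| ->
    exists2 x, x \in J :\: I & x |: I \in indep }.

Section Distance.
Variables (N : finType) (e : rel N).

Definition walk (n : nat) (x y : N) : bool :=
  [exists p : n.-tuple N, path e x p && (last x p == y)].

Definition at_dist (x y : N) (n : nat) : bool :=
  walk n x y && [forall m : 'I_n, ~~ walk m x y].

End Distance.

Section ExchangeGraph.
Variables (V : finType) (M1 M2 : matroid V).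

Definition node : finType := (V + bool)%type.
Definition elt (v : V) : node := inl v.
Definition src : node := inr false.
Definition snk : node := inr true.

Definition exch (T : {set V}) : rel node := fun x y =>
  match x, y with
  | inr false, inl a => (a \notin T) && (a |: T \in indep M1)
  | inl a, inr true => (a \notin T) && (a |: T \in indep M2)
  | inl x, inl y =>
      [&& x \in T, y \notin T & y |: (T :\ x) \in indep M1]
      || [&& y \in T, x \notin T & x |: (T :\ y) \in indep M2]
  | _, _ => false
  end.

Definition layer (T : {set V}) (i : nat) : {set V} :=
  [set v | at_dist (exch T) src (elt v) i].

End ExchangeGraph.

(* (B_1, A_1, ..., A_l, B_(l+1)) with indices shifted down by one:
   [seqB P i] is B_(i+1) and [seqA P i] is A_(i+1). *)
Record set_seq (V : finType) (l : nat) := SetSeq {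
  seqB : 'I_l.+1 -> {set V};
  seqA : 'I_l -> {set V} }.

Section AugmentingSets.
Variables (V : finType) (l : nat).
Implicit Types (P Q : set_seq V l) (T : {set V}).

Definition set_seq_sub P Q : Prop :=
  (forall i, seqB P i \subset seqB Q i) /\
  (forall i, seqA P i \subset seqA Q i).

Definition set_seq_diff Q P : set_seq V l :=
  SetSeq (fun i => seqB Q i :\: seqB P i) (fun i => seqA Q i :\: seqA P i).

(* The order of the additions and removals is immaterial when P is an
   augmenting set in G(T): then each A_k lies in T and each B_k avoids T. *)
Definition augment T P : {set V} :=
  (T :\: \bigcup_i seqA P i) :|: \bigcup_i seqB P i.

(* For i : 'I_l, [widen_ord (leqnSn l) i] has value i and [lift ord0 i] has
   value i.+1, so with k = i.+1 they index B_k and B_(k+1). *)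
Record augmenting_set (M1 M2 : matroid V) T P : Prop := AugmentingSet {
  aug_layerA : forall i : 'I_l, seqA P i \subset layer M1 M2 T (2 * i.+1);
  aug_layerB : forall i : 'I_l.+1,
    seqB P i \subset layer M1 M2 T (2 * i.+1 - 1);
  aug_width : exists w : nat,
    (forall i, #|seqB P i| = w) /\ (forall i, #|seqA P i| = w);
  aug_first : T :|: seqB P ord0 \in indep M1;
  aug_last : T :|: seqB P ord_max \in indep M2;
  aug_next : forall i : 'I_l,
    (T :\: seqA P i) :|: seqB P (lift ord0 i) \in indep M1;
  aug_prev : forall i : 'I_l,
    (T :\: seqA P i) :|: seqB P (widen_ord (leqnSn l) i) \in indep M2 }.

End AugmentingSets.

(* Main.v *)
(** Let [d v] be the distance of [v] from the source in G(S), capped at 2l + 1.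
    Grade V by [d v / 2] for M1 and by [l + 1 - ceil (d v / 2)] for M2.  No arc
    of M1 skips a layer, which says that an exchange S - a + b in M1 never has
    a grade of [b] above that of [a], and that S + b forces grade 0; reversing
    the grading, the same holds for M2.  Equivalently, for every j > 0 the
    elements of S of grade at least j are a basis of all elements of grade at
    least j.  If in each grade S may independently be modified by a swap, then
    (descending through the grades, replacing one basis of a contracted set by
    another) all swaps may be performed at once, and the result is graded
    again.  Swapping along Q in one grade and along P elsewhere gives (c)-(f).
    The gradedness of S' says that [d] is a lower bound for the distances in
    G(S'); single exchanges taken from (c)-(f) give the walks attaining it. *)
Require Import Defs.
From mathcomp Require Import all_boot zify.

Set Implicit Arguments.
Unset Strict Implicit.
Unset Printing Implicit Defensive.

(** * Extension and exchange in a single matroid *)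

Section Matroid.
Variables (V : finType) (M : matroid V).
Implicit Types (A B I J K S T W X Y : {set V}).

Lemma indep_extend I J :
  I \in indep M -> J \in indep M -> #|I| <= #|J| ->
  exists K, [/\ K \in indep M, I \subset K, K \subset I :|: J & #|K| = #|J|].
Proof.
have [n] := ubnP (#|J| - #|I|); elim: n I => // n IHn I ltn iI iJ leIJ.
have [eqIJ | ltIJ] := eqVneq #|I| #|J|.
  by exists I; split=> //; apply: subsetUl.
have {}ltIJ : #|I| < #|J| by rewrite ltn_neqAle ltIJ.
have [x /setDP[xJ xI] ixI] := indep_exchange iI iJ ltIJ.
have cxI : #|x |: I| = #|I|.+1 by rewrite cardsU1 xI.
have [||K [iK sxIK sK cK]] := IHn (x |: I) _ ixI iJ; [lia | lia |].
exists K; split=> //; first exact: subset_trans (subsetUr _ _) sxIK.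
apply: subset_trans sK _; rewrite -setUA subUset subxx andbT sub1set.
by rewrite inE xJ orbT.
Qed.

(* Independence over a contracted set [W] does not depend on the basis of [W]. *)
Lemma indep_change_basis W I J Y :
  I \subset W -> J \subset W -> [disjoint Y & W] -> #|I| = #|J| ->
  (forall K, K \in indep M -> K \subset W -> #|K| <= #|I|) ->
  I :|: Y \in indep M -> J \in indep M -> J :|: Y \in indep M.
Proof.
move=> sIW sJW dYW cIJ maxI iIY iJ.
have cIY : #|I :|: Y| = #|I| + #|Y|.
  rewrite cardsU (_ : I :&: Y = set0) ?cards0 ?subn0 //.
  by apply/eqP; rewrite setI_eq0 disjoint_sym (disjointWr sIW).
have [|K [iK sJK sK cK]] := indep_extend iJ iIY; first by lia.
have leW : #|K :&: W| <= #|I|.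
  by apply: maxI (subsetIr _ _); apply: indepS iK; apply: subsetIl.
have sY : K :\: W \subset Y.
  apply/subsetP=> x /setDP[xK xW]; have := subsetP sK x xK.
  rewrite !inE => /orP[xJ|/orP[xI|//]].
    by rewrite (subsetP sJW x xJ) in xW.
  by rewrite (subsetP sIW x xI) in xW.
(* At most [#|I|] elements of [K] lie in [W], so at least [#|Y|] lie outside it. *)
have eY : K :\: W = Y.
  apply/eqP; rewrite eqEcard sY /=.
  have := cardsID W K; lia.
apply: indepS iK; rewrite subUset sJK -eY; exact: subsetDl.
Qed.

(** The exchange axiom adds to S - v an element of the swapped set. It cannot be an old element of
    S: only [v] is available there, and [v] left with [A]. *)
Lemma exchange_in S A B v :
  S \in indep M -> (S :\: A) :|: B \in indep M -> A \subset S ->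
  [disjoint B & S] -> #|A| = #|B| -> v \in A ->
  exists2 b, b \in B & b |: (S :\ v) \in indep M.
Proof.
move=> iS iX sAS dBS cAB vA.
have cX : #|(S :\: A) :|: B| = #|S|.
  rewrite cardsU (_ : _ :&: B = set0) ?cards0 ?subn0; last first.
    by apply/eqP; rewrite setI_eq0 disjoint_sym (disjointWr (subsetDl _ _)).
  by rewrite cardsDS // -cAB subnK // subset_leq_card.
have iSv : S :\ v \in indep M by apply: indepS iS; apply: subsetDl.
have [|x /setDP[xX xS] ix] := indep_exchange iSv iX.
  by rewrite cX [#|S|](cardsD1 v) (subsetP sAS v vA).
exists x => //; move: xX xS; rewrite !inE => /orP[/andP[xA xS]|//].
rewrite xS andbT negbK => /eqP xv; by rewrite xv vA in xA.
Qed.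

(** Extend S - A + b by elements of S up to size [#|S|]. Exactly one element of S is then left out,
    and it lies in [A] because S - A was kept. *)
Lemma exchange_out S A B b :
  S \in indep M -> (S :\: A) :|: B \in indep M -> A \subset S ->
  [disjoint B & S] -> #|A| = #|B| -> b \in B ->
  exists2 a, a \in A & b |: (S :\ a) \in indep M.
Proof.
move=> iS iX sAS dBS cAB bB.
have bS : b \notin S by rewrite (disjointFr dBS bB).
have iI : b |: (S :\: A) \in indep M.
  by apply: indepS iX; rewrite setUC setUS // sub1set.
have A_gt0 : 0 < #|A| by rewrite cAB; apply/card_gt0P; exists b.
have leAS := subset_leq_card sAS.
have cI : #|b |: (S :\: A)| = (#|S| - #|A|).+1.
  by rewrite cardsU1 inE (negbTE bS) andbF cardsDS.
have [|K [iK sIK sK cK]] := indep_extend iI iS; first by lia.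
have bK : b \in K by apply: (subsetP sIK); rewrite !inE eqxx.
have [a aS aK] : exists2 a, a \in S & a \notin K.
  apply/subsetPn/negP => sSK.
  have : #|b |: S| <= #|K| by rewrite subset_leq_card // subUset sub1set bK.
  by rewrite cardsU1 bS cK ltnn.
exists a.
  apply: contraR aK => aA; apply: (subsetP sIK).
  by rewrite !inE aA aS orbT.
suff -> : b |: (S :\ a) = K by [].
apply/esym/eqP; rewrite eqEcard cardsU1 !inE (negbTE bS) andbF.
apply/andP; split; last by rewrite cK (cardsD1 a S) aS.
apply/subsetP=> x xK; have := subsetP sK x xK; rewrite !inE.
have [xa|_] := eqVneq x a; first by rewrite xa (negbTE aK) in xK.
by case: (x == b); case: (x \in S) => //=; rewrite ?andbF ?orbF.
Qed.

(** * Gradings of a matroid and swaps made grade by grade *)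

Section Graded.
Variable g : V -> nat.

Definition level j : {set V} := [set v | g v == j].
Definition above j : {set V} := [set v | j <= g v].

Definition graded S : Prop :=
  [/\ S \in indep M,
      forall b, b \notin S -> b |: S \in indep M -> g b = 0
    & forall a b, a \in S -> b \notin S -> b |: (S :\ a) \in indep M ->
        g b <= g a].

(** Grade 0 is exempt because S need not be a basis of the whole matroid. *)
Definition basis_above S : Prop :=
  forall j J, 0 < j -> J \in indep M -> J \subset above j ->
    #|J| <= #|S :&: above j|.

(** A larger [J] would supply some [x] outside S, of grade at least [j], independent together with
    the upper part of S. Either S + x is independent, although [x] has positive grade, or completing
    to size [#|S|] drops some [a] of grade below [j]: a forbidden exchange. *)
Lemma graded_basis S : graded S -> basis_above S.
Proof.
case=> iS free exc j J j_gt0 iJ sJ; rewrite leqNgt; apply/negP=> ltJ.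
have iSj : S :&: above j \in indep M by apply: indepS iS; apply: subsetIl.
have [x /setDP[xJ xSj] ix] := indep_exchange iSj iJ ltJ.
have gx : j <= g x by have := subsetP sJ x xJ; rewrite inE.
have xS : x \notin S by apply: contra xSj => xS; rewrite !inE xS.
have cI : #|x |: (S :&: above j)| = #|S :&: above j|.+1 by rewrite cardsU1 xSj.
have [sS|] := boolP (S \subset above j).
  by rewrite (setIidPl sS) in ix; have := free x xS ix => g0;
    rewrite g0 leqNgt j_gt0 in gx.
move=> nsS.
have ltS : #|S :&: above j| < #|S|.
  by apply: proper_card; rewrite properE subsetIl subsetI subxx.
have [|K [iK sIK sK cK]] := indep_extend ix iS; first by rewrite cI.
have xK : x \in K by apply: (subsetP sIK); rewrite !inE eqxx.
have [a aS aK] : exists2 a, a \in S & a \notin K.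
  apply/subsetPn/negP => sSK.
  have : #|x |: S| <= #|K| by rewrite subset_leq_card // subUset sub1set xK.
  by rewrite cardsU1 xS cK ltnn.
have ga : g a < j.
  rewrite ltnNge; apply: contra aK => ga; apply: (subsetP sIK).
  by rewrite !inE aS ga orbT.
suff eK : x |: (S :\ a) = K.
  by have := exc a x aS xS; rewrite eK iK leqNgt (leq_trans ga gx) => /(_ isT).
apply/esym/eqP; rewrite eqEcard cardsU1 !inE (negbTE xS) andbF.
apply/andP; split; last by rewrite cK (cardsD1 a S) aS.
apply/subsetP=> y yK; have := subsetP sK y yK; rewrite !inE.
have [ya|_] := eqVneq y a; first by rewrite ya (negbTE aK) in yK.
by case: (y == x); case: (y \in S).
Qed.

(** A violating [b] would be independent together with all of S in grades at least [g b], one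
    element too many; this is [big]. *)
Lemma basis_graded S : S \in indep M -> basis_above S -> graded S.
Proof.
move=> iS max.
have big b T : b \notin S -> 0 < g b -> T \in indep M ->
    b \in T -> S :&: above (g b) \subset T -> False.
  move=> bS gb iT bT sT.
  have := max (g b) (b |: (S :&: above (g b))) gb.
  rewrite cardsU1 !inE (negbTE bS) /= ltnn => absurd.
  suff: false by []. apply: absurd; last first.
    by rewrite subUset subsetIr sub1set inE leqnn.
  by apply: indepS iT; rewrite subUset sub1set bT.
split=> // [b bS ib | a b aS bS iab].
  have [//|gb] := posnP (g b); case: (big b _ bS gb ib).
    by rewrite !inE eqxx.
  by apply: subset_trans (subsetIl _ _) (subsetUr _ _).
rewrite leqNgt; apply/negP=> lt_ab.
apply: (big b _ bS _ iab); rewrite ?inE ?eqxx //; first by lia.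
apply/subsetP=> x; rewrite !inE => /andP[-> gx].
rewrite andbT; have [xa|_] := eqVneq x a; last by rewrite orbT.
by rewrite xa leqNgt lt_ab in gx.
Qed.

Variable N : nat.
Hypothesis g_le : forall v, g v <= N.

Lemma above0 : above 0 = setT.
Proof. by apply/setP=> x; rewrite !inE. Qed.

Lemma above_empty j : N < j -> above j = set0.
Proof. by move=> ltN; apply/setP=> x; rewrite !inE; have := g_le x; lia. Qed.

Lemma setI_aboveS S j :
  S :&: above j = (S :&: above j.+1) :|: (S :&: level j).
Proof.
apply/setP=> x; rewrite !inE -andb_orr leq_eqVlt orbC; congr (_ && (_ || _)).
exact: eq_sym.
Qed.

Lemma card_aboveS S j :
  #|S :&: above j| = #|S :&: above j.+1| + #|S :&: level j|.
Proof.
rewrite setI_aboveS cardsU (_ : _ :&: (S :&: level j) = set0) ?cards0 ?subn0 //.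
apply/setP=> x; rewrite !inE; apply/negP.
by move=> /andP[/andP[_ lt] /andP[_ /eqP eq]]; lia.
Qed.

Lemma card_above_eq S X :
  (forall j, 0 < j <= N -> #|X :&: level j| = #|S :&: level j|) ->
  forall j, 0 < j -> #|X :&: above j| = #|S :&: above j|.
Proof.
move=> eqL j; have [n] := ubnP (N.+1 - j).
elim: n j => // n IHn j ltn j_gt0.
have [ltN|leN] := ltnP N j; first by rewrite above_empty // !setI0.
rewrite (card_aboveS X) (card_aboveS S) eqL ?j_gt0 // IHn //; lia.
Qed.

(** Descending induction on the grade. Above grade [j], S and [X] have equally many elements, so
    both parts are bases there and one may replace the other underneath the elements of [X] of grade
    [j]. *)
Lemma indep_levels S X :
  basis_above S ->
  (forall j, 0 < j <= N -> #|X :&: level j| = #|S :&: level j|) ->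
  (forall j, j <= N -> (S :&: above j.+1) :|: (X :&: level j) \in indep M) ->
  X \in indep M.
Proof.
move=> max eqL iL.
suff aux n j : N.+1 - j < n -> X :&: above j \in indep M.
  by have := aux N.+2 0; rewrite above0 setIT subn0; apply.
elim: n j => // n IHn j ltn.
have [ltN|leN] := ltnP N j; first by rewrite above_empty // setI0 indep0.
rewrite setI_aboveS.
apply: (@indep_change_basis (above j.+1) (S :&: above j.+1)).
- exact: subsetIr.
- exact: subsetIr.
- rewrite -setI_eq0; apply/eqP/setP=> x; rewrite !inE; apply/negP.
  by move=> /andP[/andP[_ /eqP eq] lt]; lia.
- by apply/esym/card_above_eq.
- by move=> K; apply: max.
- exact: iL.
- by apply: IHn; lia.
Qed.

(** No balance is asked in grade 0, where an augmentation adds elements without removing any. *)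
Record levelwise_swap S A B : Prop := LevelwiseSwap {
  swap_sub : A \subset S;
  swap_dis : [disjoint B & S];
  swap_card : forall j, 0 < j <= N -> #|A :&: level j| = #|B :&: level j|;
  swap_indep : forall j, j <= N ->
    (S :\: (A :&: level j)) :|: (B :&: level j) \in indep M }.

Lemma swap_card_level S A B : levelwise_swap S A B -> forall j, 0 < j <= N ->
  #|((S :\: A) :|: B) :&: level j| = #|S :&: level j|.
Proof.
case=> sAS dBS cAB _ j jN.
rewrite setIUl cardsU (_ : _ :&: (B :&: _) = set0) ?cards0 ?subn0; last first.
  apply/setP=> x; rewrite !inE; apply/negP.
  by move=> /andP[/andP[/andP[_ xS] _] /andP[xB _]];
    rewrite (disjointFr dBS xB) in xS.
have -> : (S :\: A) :&: level j = (S :&: level j) :\: (A :&: level j).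
  by apply/setP=> x; rewrite !inE; case: (g x == j); rewrite ?andbT ?andbF.
rewrite cardsDS ?setSI // cAB // subnK // -cAB //.
by rewrite subset_leq_card // setSI.
Qed.

Lemma swap_in_indep S A B :
  graded S -> levelwise_swap S A B -> (S :\: A) :|: B \in indep M.
Proof.
move=> gS sw; apply: (indep_levels (graded_basis gS) (swap_card_level sw)).
(* The swap confined to grade [j] leaves S intact above [j], so it contains the set required. *)
move=> j jN; apply: indepS (swap_indep sw jN).
apply/subsetP=> x; rewrite !inE => /orP[/andP[xS lt]|/andP[/orP[|] ]].
- by rewrite xS andbT negb_and (gtn_eqF lt) orbT.
- by move=> /andP[xA xS] _; rewrite xS (negbTE xA).
- by move=> -> ->; rewrite orbT.
Qed.

(** The swap preserves the count in every positive grade, so maximality above each grade carries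
    over. *)
Lemma swap_graded S A B :
  graded S -> levelwise_swap S A B -> graded ((S :\: A) :|: B).
Proof.
move=> gS sw; apply: basis_graded; first exact: swap_in_indep.
move=> j J j_gt0 iJ sJ.
by rewrite (card_above_eq (swap_card_level sw)) // (graded_basis gS).
Qed.

(** Nestedness makes the mixed sets agree with the primed pair in grade [k] and with the unprimed
    pair elsewhere; balance and independence are tested one grade at a time. *)
Lemma swap_mix S A B A' B' k :
  A \subset A' -> B \subset B' ->
  levelwise_swap S A B -> levelwise_swap S A' B' ->
  levelwise_swap S (A :|: (A' :&: level k)) (B :|: (B' :&: level k)).
Proof.
move=> sA sB [sAS dBS cAB iAB] [sAS' dBS' cAB' iAB'].
have mix X X' j : X \subset X' ->
    (X :|: (X' :&: level k)) :&: level j = (if j == k then X' else X) :&: level j.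
  move=> sX; apply/setP=> x; rewrite !inE.
  have [->|_] := eqVneq (g x) j; rewrite ?andbT ?andbF //.
  case: (j == k); rewrite ?andbT ?andbF ?orbF //.
  by case: (boolP (x \in X)) => // /(subsetP sX) ->.
split=> [||j jN|j jN].
- by rewrite subUset sAS (subset_trans _ sAS') // subsetIl.
- by apply: disjointWl dBS'; rewrite subUset sB subsetIl.
- by rewrite !mix //; case: ifP => _; [apply: cAB' | apply: cAB].
- by rewrite !mix //; case: ifP => _; [apply: iAB' | apply: iAB].
Qed.

(** Swapping the difference in grade [k] after the small swap stays inside the result of one mixed
    swap of S. *)
Lemma swap_indep_diff S A B A' B' k :
  graded S -> A \subset A' -> B \subset B' ->
  levelwise_swap S A B -> levelwise_swap S A' B' ->
  (((S :\: A) :|: B) :\: ((A' :\: A) :&: level k))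
     :|: ((B' :\: B) :&: level k) \in indep M.
Proof.
move=> gS sA sB sw sw'.
apply: indepS (swap_in_indep gS (swap_mix k sA sB sw sw')).
apply/subsetP=> x; rewrite !inE.
by case: (x \in A); case: (x \in A'); case: (g x == k); case: (x \in S);
  case: (x \in B); case: (x \in B').
Qed.

End Graded.
End Matroid.

(** * Walks built and cut at their last arc *)

Section Walk.
Variables (N : finType) (e : rel N).

Lemma walkP n x y :
  reflect (exists p, [/\ size p = n, path e x p & last x p = y]) (walk e n x y).
Proof.
apply: (iffP existsP) => [[p /andP[ep /eqP lp]] | [p [sp ep lp]]].
  by exists p; rewrite size_tuple.
by move/eqP: sp => sp; exists (Tuple sp); rewrite /= ep lp eqxx.
Qed.

Lemma walk0 x y : walk e 0 x y = (x == y).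
Proof.
by apply/walkP/eqP=> [[p [/size0nil-> _]] | ->]; last exists [::].
Qed.

Lemma walkS n x y z : walk e n x y -> e y z -> walk e n.+1 x z.
Proof.
case/walkP=> p [sp ep lp] eyz; apply/walkP; exists (rcons p z).
by rewrite size_rcons sp rcons_path ep lp last_rcons.
Qed.

Lemma walkS_inv n x z : walk e n.+1 x z -> exists2 y, walk e n x y & e y z.
Proof.
case/walkP=> p; case/lastP: p => [[]//|p w [sp ep lp]].
move: sp ep lp; rewrite size_rcons rcons_path last_rcons.
move=> [sp] /andP[ep ew] <-; exists (last x p) => //.
by apply/walkP; exists p.
Qed.

End Walk.

(** Lets the members of an augmenting set be recovered from their union by grade, so that swaps need
    only two sets. *)
Lemma bigcup_level (V I : finType) (F : I -> {set V}) (g : V -> nat)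
    (c : I -> nat) i :
  injective c -> (forall k v, v \in F k -> g v = c k) ->
  (\bigcup_k F k) :&: level g (c i) = F i.
Proof.
move=> injc gF; apply/setP=> v; rewrite !inE.
apply/andP/idP => [[/bigcupP[k _ vk] /eqP gv]|vi].
  by rewrite -(injc k i) // -gv (gF k).
by split; [apply/bigcupP; exists i | rewrite (gF i)].
Qed.

(** * Potentials, parity and distances in the exchange graph *)

Section Exchange.
Variables (V : finType) (M1 M2 : matroid V).
Implicit Types (T : {set V}) (v a b : V).

Notation G T := (exch M1 M2 T).

(** Each arc raises [f] by at most one. A walk to an element never passes through the sink, which
    has no outgoing arc. *)
Lemma walk_potential T (f : V -> nat) :
  (forall b, b \notin T -> b |: T \in indep M1 -> f b <= 1) ->
  (forall a b, a \in T -> b \notin T -> b |: (T :\ a) \in indep M1 ->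
     f b <= (f a).+1) ->
  (forall a b, a \in T -> b \notin T -> b |: (T :\ a) \in indep M2 ->
     f a <= (f b).+1) ->
  forall n v, walk (G T) n (src V) (elt v) -> f v <= n.
Proof.
move=> f0 f1 f2; elim=> [|n IHn] v; first by rewrite walk0.
case/walkS_inv=> -[a|[]] wa //=; last first.
  by case/andP=> vT iv; apply: leq_trans (f0 v vT iv) _.
by case/orP=> /and3P[h1 h2 h3]; apply: leq_trans (_ : (f a).+1 <= _);
  rewrite ?ltnS ?IHn //; [apply: f1 | apply: f2].
Qed.

Lemma walk_parity T n v :
  walk (G T) n (src V) (elt v) -> odd n = (v \notin T).
Proof.
elim: n v => [|n IHn] v; first by rewrite walk0.
case/walkS_inv=> -[a|[]] wa //=; last first.
  (* The last arc leaves the source; as no arc enters it, the walk before has length 0. *)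
  case/andP=> -> _; move: wa; case: n {IHn} => // n /walkS_inv[[a|[]]] //= _.
by case/orP=> /and3P[h1 h2 _];
  rewrite (IHn a wa) ?h1 ?h2 ?(negbTE h1) ?(negbTE h2).
Qed.

(* Capping at [n] makes the potential finite on the vertices that the source
   does not reach. *)
Definition capped_dist n T v :=
  find (fun m => walk (G T) m (src V) (elt v)) (iota 0 n).

Lemma capped_dist_le n T v : capped_dist n T v <= n.
Proof. by rewrite -{2}(size_iota 0 n) find_size. Qed.

Lemma capped_dist_walk n T v :
  capped_dist n T v < n -> walk (G T) (capped_dist n T v) (src V) (elt v).
Proof.
move=> lt.
have : has (fun m => walk (G T) m (src V) (elt v)) (iota 0 n).
  by rewrite has_find size_iota.
by move/(nth_find 0); rewrite nth_iota.
Qed.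

Lemma capped_dist_min n T m v :
  walk (G T) m (src V) (elt v) -> capped_dist n T v <= m.
Proof.
move=> wm; rewrite leqNgt; apply/negP=> lt.
have := before_find 0 lt; rewrite nth_iota ?add0n ?wm //.
exact: leq_trans lt (capped_dist_le n T v).
Qed.

Lemma capped_dist_step n T u v :
  G T (elt u) (elt v) -> capped_dist n T v <= (capped_dist n T u).+1.
Proof.
move=> euv; have [lt|ge] := ltnP (capped_dist n T u) n.
  by apply: capped_dist_min; apply: walkS euv; apply: capped_dist_walk.
by apply: leq_trans (capped_dist_le _ _ _) _; apply: leq_trans ge _.
Qed.

Lemma capped_dist_gt0 n T v : 0 < n -> 0 < capped_dist n T v.
Proof.
move=> n_gt0; rewrite lt0n; apply/eqP=> d0.
by have := @capped_dist_walk n T v; rewrite d0 walk0 => /(_ n_gt0).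
Qed.

Lemma capped_dist_layer n T v i :
  v \in layer M1 M2 T i -> i <= n -> capped_dist n T v = i.
Proof.
rewrite inE => /andP[wi /forallP min] le_in; apply/eqP.
rewrite eqn_leq capped_dist_min //= leqNgt; apply/negP=> lt.
have := min (Ordinal lt); rewrite capped_dist_walk //.
exact: leq_trans lt le_in.
Qed.

(** * The two gradings by distance in G(S) *)

Section Augment.
Variables (l : nat) (S : {set V}).
Hypothesis S_indep : S \in indep M1 :&: indep M2.
Hypothesis S_dist : at_dist (G S) (src V) (snk V) (2 * (l + 1)).
Implicit Types (P Q : set_seq V l).

Let d := capped_dist (2 * l + 1) S.
Let rk1 v := (d v)./2.
(* The second matroid sees the layers in reverse order. *)
Let rk2 v := l.+1 - uphalf (d v).

Let d_le v : d v <= 2 * l + 1. Proof. exact: capped_dist_le. Qed.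
Let d_gt0 v : 0 < d v. Proof. by apply: capped_dist_gt0; rewrite addn1. Qed.

Let rk1_le v : rk1 v <= l.
Proof. by have := d_le v; rewrite /rk1; lia. Qed.

Let rk2_le v : rk2 v <= l.
Proof. by have := d_gt0 v; rewrite /rk2; lia. Qed.

(** The cap 2l + 1 is itself odd, so parity also survives at capped vertices. *)
Lemma odd_dist v : v \notin S -> odd (d v).
Proof.
move=> vS; have [lt|ge] := ltnP (d v) (2 * l + 1).
  by rewrite (walk_parity (capped_dist_walk lt)).
by have := d_le v; lia.
Qed.

(** An arc of M1 from [a] to [b] raises [d] by at most one, and [d b] is odd, so the halves do not
    increase. *)
Lemma graded1 : graded M1 rk1 S.
Proof.
split=> [|b bS ib|a b aS bS iab]; first by case/setIP: S_indep.
  have : d b <= 1.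
    by apply: capped_dist_min; apply: (@walkS _ _ _ _ (src V));
      rewrite ?walk0 //= bS.
  by rewrite /rk1; case: (d b) => [|[]].
have : d b <= (d a).+1 by apply: capped_dist_step; rewrite /= aS bS iab.
by have := odd_dist bS; rewrite /rk1; lia.
Qed.

(** The length of the shortest path from s to t enters here: an arc from [b] to t forces [d b] to be
    2l + 1, which is grade 0. *)
Lemma graded2 : graded M2 rk2 S.
Proof.
split=> [|b bS ib|a b aS bS iab]; first by case/setIP: S_indep.
  have [lt|ge] := ltnP (d b) (2 * l + 1); last first.
    by have := d_le b; rewrite /rk2; lia.
  have /walkS wt := capped_dist_walk lt.
  have {wt}wt := wt (snk V); rewrite /= bS ib in wt.
  case/andP: S_dist => _ /forallP min.
  have ltd : (d b).+1 < 2 * (l + 1) by lia.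
  by have := min (Ordinal ltd); rewrite wt.
have : d a <= (d b).+1 by apply: capped_dist_step; rewrite /= aS bS iab orbT.
by have := odd_dist bS; rewrite /rk2; lia.
Qed.

(** * An augmenting set as a levelwise swap in both matroids *)

Section Levels.
Variable P : set_seq V l.
Hypothesis augP : augmenting_set M1 M2 S P.

Lemma seqA_dist i v : v \in seqA P i -> d v = 2 * i.+1.
Proof.
move=> vA; apply: capped_dist_layer; first exact: subsetP (aug_layerA augP i) v vA.
by have := ltn_ord i; lia.
Qed.

Lemma seqB_dist i v : v \in seqB P i -> d v = 2 * i + 1.
Proof.
move=> vB; have -> : 2 * i + 1 = 2 * i.+1 - 1 by lia.
apply: capped_dist_layer; first exact: subsetP (aug_layerB augP i) v vB.
by have := ltn_ord i; lia.
Qed.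

Lemma cupA_sub : \bigcup_i seqA P i \subset S.
Proof.
apply/bigcupsP=> i _; apply/subsetP=> v /(subsetP (aug_layerA augP i)).
rewrite inE => /andP[/walk_parity + _].
by rewrite mul2n odd_double => /esym/negbT; rewrite negbK.
Qed.

Lemma cupB_dis : [disjoint \bigcup_i seqB P i & S].
Proof.
rewrite disjoint_subset; apply/bigcupsP=> i _; apply/subsetP=> v.
move/(subsetP (aug_layerB augP i)); rewrite !inE => /andP[/walk_parity <- _].
lia.
Qed.

Lemma seqA_rk1 (i : 'I_l) : (\bigcup_k seqA P k) :&: level rk1 i.+1 = seqA P i.
Proof.
apply: (bigcup_level (c := fun k : 'I_l => k.+1)).
  by move=> j k [] /ord_inj.
move=> k v /seqA_dist.
by rewrite /rk1 => ->; lia.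
Qed.

Lemma seqB_rk1 (i : 'I_l.+1) : (\bigcup_k seqB P k) :&: level rk1 i = seqB P i.
Proof.
apply: (bigcup_level (c := val)) => [|k v /seqB_dist]; first exact: val_inj.
by rewrite /rk1 /= => ->; lia.
Qed.

Lemma seqA_rk2 (i : 'I_l) : (\bigcup_k seqA P k) :&: level rk2 (l - i) = seqA P i.
Proof.
apply: (bigcup_level (c := fun k : 'I_l => l - k)) => [j k eq | k v /seqA_dist].
  by apply: ord_inj; have := ltn_ord j; have := ltn_ord k; lia.
by rewrite /rk2 => ->; lia.
Qed.

Lemma seqB_rk2 (i : 'I_l.+1) :
  (\bigcup_k seqB P k) :&: level rk2 (l - i) = seqB P i.
Proof.
apply: (bigcup_level (c := fun k : 'I_l.+1 => l - k)) => [j k eq | k v /seqB_dist].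
  by apply: ord_inj; have := ltn_ord j; have := ltn_ord k; lia.
by rewrite /rk2 => ->; lia.
Qed.

Lemma seqA_rk1_0 : (\bigcup_i seqA P i) :&: level rk1 0 = set0.
Proof.
apply/setP=> v; rewrite !inE; apply/negP=> /andP[/bigcupP[i _ /seqA_dist dv]].
by rewrite /rk1 dv; lia.
Qed.

Lemma seqA_rk2_0 : (\bigcup_i seqA P i) :&: level rk2 0 = set0.
Proof.
apply/setP=> v; rewrite !inE; apply/negP=> /andP[/bigcupP[i _ /seqA_dist dv]].
by rewrite /rk2 dv; have := ltn_ord i; lia.
Qed.

(** For M1, A_k and B_(k+1) share grade k and B_1 is alone in grade 0, so (c) and (e) are the swaps
    within single grades. *)
Lemma augmenting_swap1 :
  levelwise_swap M1 rk1 l S (\bigcup_i seqA P i) (\bigcup_i seqB P i).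
Proof.
case: (aug_width augP) => w [cB cA].
split; [exact: cupA_sub | exact: cupB_dis | |].
  case=> // j ltj.
  by rewrite (seqA_rk1 (Ordinal ltj)) (seqB_rk1 (lift ord0 (Ordinal ltj))) cA cB.
case=> [_|j ltj].
  by rewrite seqA_rk1_0 setD0 (seqB_rk1 ord0) (aug_first augP).
rewrite (seqA_rk1 (Ordinal ltj)) (seqB_rk1 (lift ord0 (Ordinal ltj))).
exact: (aug_next augP).
Qed.

(** For M2, A_k and B_k share grade l + 1 - k and B_(l+1) is alone in grade 0, so (d) and (f) take
    that role. *)
Lemma augmenting_swap2 :
  levelwise_swap M2 rk2 l S (\bigcup_i seqA P i) (\bigcup_i seqB P i).
Proof.
case: (aug_width augP) => w [cB cA].
have rk2A j (lt : l - j.+1 < l) : j < l ->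
    (\bigcup_i seqA P i) :&: level rk2 j.+1 = seqA P (Ordinal lt).
  by move=> ltj; rewrite -seqA_rk2 /= subKn.
have rk2B j (lt : l - j.+1 < l) : j < l ->
    (\bigcup_i seqB P i) :&: level rk2 j.+1 =
    seqB P (widen_ord (leqnSn l) (Ordinal lt)).
  by move=> ltj; rewrite -seqB_rk2 /= subKn.
split; [exact: cupA_sub | exact: cupB_dis | |].
  case=> // j ltj; have lt : l - j.+1 < l by lia.
  by rewrite (rk2A _ lt) // (rk2B _ lt) // cA cB.
case=> [_|j ltj].
  by rewrite seqA_rk2_0 setD0 -(subnn l) (seqB_rk2 ord_max) (aug_last augP).
have lt : l - j.+1 < l by lia.
rewrite (rk2A _ lt) // (rk2B _ lt) //; exact: (aug_prev augP).
Qed.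

(** The augmented set is graded for both matroids, which makes [d], still measured in G(S), a
    potential on its exchange graph. *)
Lemma augment_walk_ge n v :
  walk (G (augment S P)) n (src V) (elt v) -> d v <= n.
Proof.
have [_ free1 exc1] := swap_graded rk1_le graded1 augmenting_swap1.
have [_ _ exc2] := swap_graded rk2_le graded2 augmenting_swap2.
apply: walk_potential => [b bT ib | a b aT bT iab | a b aT bT iab].
- by have := free1 b bT ib; rewrite /rk1; lia.
- by have := exc1 a b aT bT iab; rewrite /rk1; lia.
(* The bounds on [d] keep the subtraction in [rk2] from truncating. *)
- have := exc2 a b aT bT iab; have := d_le b; have := d_le a.
  by rewrite /rk2; lia.
Qed.

End Levels.

(** * The difference of two nested augmenting sets *)

Section Difference.
Variables P Q : set_seq V l.
Hypotheses (augP : augmenting_set M1 M2 S P) (augQ : augmenting_set M1 M2 S Q).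
Hypothesis sub_PQ : set_seq_sub P Q.

Let S' := augment S P.
Let D := set_seq_diff Q P.
Let A := (\bigcup_i seqA Q i) :\: (\bigcup_i seqA P i).
Let B := (\bigcup_i seqB Q i) :\: (\bigcup_i seqB P i).

Let setID_level X Y (L : {set V}) : (X :\: Y) :&: L = (X :&: L) :\: (Y :&: L).
Proof. by apply/setP=> v; rewrite !inE; case: (v \in L); rewrite ?andbT ?andbF. Qed.

Let sub_cupA : \bigcup_i seqA P i \subset \bigcup_i seqA Q i.
Proof.
apply/bigcupsP=> i _; apply: subset_trans (proj2 sub_PQ i) _.
exact: bigcup_sup.
Qed.

Let sub_cupB : \bigcup_i seqB P i \subset \bigcup_i seqB Q i.
Proof.
apply/bigcupsP=> i _; apply: subset_trans (proj1 sub_PQ i) _.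
exact: bigcup_sup.
Qed.

Lemma diffA_rk1 (i : 'I_l) : seqA D i = A :&: level rk1 i.+1.
Proof. by rewrite setID_level !seqA_rk1. Qed.

Lemma diffB_rk1 (i : 'I_l.+1) : seqB D i = B :&: level rk1 i.
Proof. by rewrite setID_level !seqB_rk1. Qed.

Lemma diffA_rk2 (i : 'I_l) : seqA D i = A :&: level rk2 (l - i).
Proof. by rewrite setID_level !seqA_rk2. Qed.

Lemma diffB_rk2 (i : 'I_l.+1) : seqB D i = B :&: level rk2 (l - i).
Proof. by rewrite setID_level !seqB_rk2. Qed.

Lemma diff_indep1 k :
  (S' :\: (A :&: level rk1 k)) :|: (B :&: level rk1 k) \in indep M1.
Proof.
exact: swap_indep_diff rk1_le _ _ _ _ _ k graded1 sub_cupA sub_cupB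
  (augmenting_swap1 augP) (augmenting_swap1 augQ).
Qed.

Lemma diff_indep2 k :
  (S' :\: (A :&: level rk2 k)) :|: (B :&: level rk2 k) \in indep M2.
Proof.
exact: swap_indep_diff rk2_le _ _ _ _ _ k graded2 sub_cupA sub_cupB
  (augmenting_swap2 augP) (augmenting_swap2 augQ).
Qed.

Lemma diff_first : S' :|: seqB D ord0 \in indep M1.
Proof.
have := diff_indep1 0; rewrite diffB_rk1 [A :&: _]setID_level.
by rewrite !seqA_rk1_0 // set0D setD0.
Qed.

Lemma diff_last : S' :|: seqB D ord_max \in indep M2.
Proof.
have := diff_indep2 0; rewrite diffB_rk2 subnn [A :&: _]setID_level.
by rewrite !seqA_rk2_0 // set0D setD0.
Qed.

Lemma diff_next (i : 'I_l) :
  (S' :\: seqA D i) :|: seqB D (lift ord0 i) \in indep M1.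
Proof. by rewrite diffA_rk1 diffB_rk1; apply: diff_indep1. Qed.

Lemma diff_prev (i : 'I_l) :
  (S' :\: seqA D i) :|: seqB D (widen_ord (leqnSn l) i) \in indep M2.
Proof. by rewrite diffA_rk2 diffB_rk2; apply: diff_indep2. Qed.

Lemma diff_width :
  exists w : nat, (forall i, #|seqB D i| = w) /\ (forall i, #|seqA D i| = w).
Proof.
have [[w [cBP cAP]] [w' [cBQ cAQ]]] := (aug_width augP, aug_width augQ).
exists (w' - w); split=> i; rewrite /= cardsDS.
- by rewrite cBP cBQ.
- exact: (proj1 sub_PQ).
- by rewrite cAP cAQ.
- exact: (proj2 sub_PQ).
Qed.

Lemma diffA_sub i : seqA D i \subset S'.
Proof.
rewrite diffA_rk1; apply/subsetP=> v /setIP[/setDP[vQ vP] _].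
by rewrite !inE vP (subsetP (cupA_sub augQ) v vQ).
Qed.

Lemma diffB_dis i : [disjoint seqB D i & S'].
Proof.
rewrite diffB_rk1 disjoint_subset; apply/subsetP=> v.
move=> /setIP[/setDP[vQ vP] _].
by rewrite !inE (negbTE vP) (disjointFr (cupB_dis augQ) vQ) andbF.
Qed.

Lemma diff_arc1 (i : 'I_l) b : b \in seqB D (lift ord0 i) ->
  exists2 a, a \in seqA D i & G S' (elt a) (elt b).
Proof.
have [w [cB cA]] := diff_width => bB.
have iS' := swap_in_indep rk1_le graded1 (augmenting_swap1 augP).
have cAB : #|seqA D i| = #|seqB D (lift ord0 i)| by rewrite cA cB.
have [a aA ia] := exchange_out iS' (diff_next i) (diffA_sub i) (diffB_dis _) cAB bB.
exists a => //; rewrite /= (subsetP (diffA_sub i) a aA) ia.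
by rewrite (disjointFr (diffB_dis _) bB).
Qed.

Lemma diff_arc2 (i : 'I_l) a : a \in seqA D i ->
  exists2 b, b \in seqB D (widen_ord (leqnSn l) i) & G S' (elt b) (elt a).
Proof.
have [w [cB cA]] := diff_width => aA.
have iS' := swap_in_indep rk2_le graded2 (augmenting_swap2 augP).
have cAB : #|seqA D i| = #|seqB D (widen_ord (leqnSn l) i)| by rewrite cA cB.
have [b bB ib] := exchange_in iS' (diff_prev i) (diffA_sub i) (diffB_dis _) cAB aA.
exists b => //; rewrite /= (subsetP (diffA_sub i) a aA) ib.
by rewrite (disjointFr (diffB_dis _) bB) orbT.
Qed.

(** Traced backwards two arcs at a time: an M1 exchange leads to the preceding A, an M2 exchange to
    the B before it, and (c) gives the arc from s. *)
Lemma diffB_walk (i : 'I_l.+1) v :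
  v \in seqB D i -> walk (G S') (2 * i + 1) (src V) (elt v).
Proof.
case: i v; elim=> [|k IHk] lt v vB.
  have -> : 2 * 0 + 1 = 1 by [].
  apply: (@walkS _ _ _ _ (src V)); first by rewrite walk0.
  rewrite (_ : Ordinal lt = ord0) in vB; last exact: val_inj.
  rewrite /= (disjointFr (diffB_dis _) vB) /=.
  by apply: indepS diff_first; rewrite setUC setUS // sub1set.
have ltk : k < l by [].
rewrite (_ : Ordinal lt = lift ord0 (Ordinal ltk)) in vB; last exact: val_inj.
have [a aA eav] := diff_arc1 vB; have [b bB eba] := diff_arc2 aA.
have -> : 2 * k.+1 + 1 = (2 * k + 1).+2 by lia.
apply: walkS eav; apply: walkS eba.
apply: (IHk (ltnW lt)).
by rewrite (_ : Ordinal _ = widen_ord (leqnSn l) (Ordinal ltk)) //; apply: val_inj.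
Qed.

Lemma diffA_walk (i : 'I_l) v :
  v \in seqA D i -> walk (G S') (2 * i.+1) (src V) (elt v).
Proof.
move=> /diff_arc2[b /diffB_walk wb ebv].
have -> : 2 * i.+1 = (2 * i + 1).+1 by lia.
exact: walkS wb ebv.
Qed.

(** The potential bound excludes any shorter walk. *)
Lemma augment_layer v : walk (G S') (d v) (src V) (elt v) ->
  v \in layer M1 M2 S' (d v).
Proof.
move=> wv; rewrite inE /at_dist wv; apply/forallP=> m; apply/negP.
by move/(augment_walk_ge augP); rewrite leqNgt ltn_ord.
Qed.

Lemma diff_layerA i : seqA D i \subset layer M1 M2 S' (2 * i.+1).
Proof.
apply/subsetP=> v vD; have := diffA_walk vD.
(* The old distance of [v] is known because [v] lies in a layer of [Q]. *)
have <- : d v = 2 * i.+1 by case/setDP: vD => /(seqA_dist augQ).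
exact: augment_layer.
Qed.

Lemma diff_layerB i : seqB D i \subset layer M1 M2 S' (2 * i.+1 - 1).
Proof.
have -> : 2 * i.+1 - 1 = 2 * i + 1 by lia.
apply/subsetP=> v vD; have := diffB_walk vD.
have <- : d v = 2 * i + 1 by case/setDP: vD => /(seqB_dist augQ).
exact: augment_layer.
Qed.

End Difference.
End Augment.
End Exchange.

Theorem theorem6p13 (V : finType) (M1 M2 : matroid V) (l : nat)
    (S : {set V}) (P Q : set_seq V l) :
  S \in indep M1 :&: indep M2 ->
  at_dist (exch M1 M2 S) (src V) (snk V) (2 * (l + 1)) ->
  augmenting_set M1 M2 S P ->
  augmenting_set M1 M2 S Q ->
  set_seq_sub P Q ->
  augmenting_set M1 M2 (augment S P) (set_seq_diff Q P).
Proof.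
move=> iS dS augP augQ subPQ; split.
- exact: (diff_layerA iS dS augP augQ subPQ).
- exact: (diff_layerB iS dS augP augQ subPQ).
- exact: (diff_width augP augQ subPQ).
- exact: (diff_first iS dS augP augQ subPQ).
- exact: (diff_last iS dS augP augQ subPQ).
- exact: (diff_next iS dS augP augQ subPQ).
- exact: (diff_prev iS dS augP augQ subPQ).
Qed.
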